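(* Let $(B,p)$ be a feasible Brascamp-Lieb datum with $B_j\in\mathbb{R}^{n_j\times n}$ for each $j\in[m]$. For $A=(A_j)_{j\in[m]}$ with $A_j\in\mathbb{S}^{n_j}_{++}$, define $$\mathrm{BL}(B,p;A) := \left(\frac{\prod_{j\in[m]}\det(A_j)^{p_j}}{\det\left(\sum_{j\in[m]}p_jB_j^\top A_jB_j\right)}\right)^{1/2}.$$ Then $\mathrm{BL}(B,p;A)$ is jointly geodesically log-concave with respect to $A=(A_j)_{j\in[m]}$ on $\mathbb{S}^{n_1}_{++}\times\cdots\times\mathbb{S}^{n_m}_{++}$; that is, for all $P=(P_j)_{j\in[m]}$, $Q=(Q_j)_{j\in[m]}$ with $P_j,Q_j\in\mathbb{S}^{n_j}_{++}$ and all $t\in[0,1]$, $$\log\mathrm{BL}(B,p;(P_j\#_tQ_j)_{j\in[m]}) \ge (1-t)\log\mathrm{BL}(B,p;P)+t\log\mathrm{BL}(B,p;Q).$$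
   Context: A Brascamp-Lieb datum $(B,p)$ consists of positive integers $n,m,n_1,\dots,n_m$, an $m$-tuple $B=(B_j)_{j\in[m]}$ of surjective linear maps $B_j:\mathbb{R}^n\to\mathbb{R}^{n_j}$ (matrices in $\mathbb{R}^{n_j\times n}$), and non-negative reals $p=(p_j)_{j\in[m]}$. The Brascamp-Lieb constant $\mathrm{BL}(B,p)$ is the smallest constant $C$ such that $\int_{\mathbb{R}^n}\prod_j f_j(B_jx)^{p_j}dx\le C\prod_j(\int_{\mathbb{R}^{n_j}}f_j)^{p_j}$ for all non-negative Lebesgue measurable $f_j:\mathbb{R}^{n_j}\to\mathbb{R}$; the datum is feasible if $\mathrm{BL}(B,p)<\infty$ (equivalently, $n=\sum_j p_jn_j$ and $\dim V\le\sum_j p_j\dim(B_jV)$ for every subspace $V\subseteq\mathbb{R}^n$). $\mathbb{S}^d_{++}$ denotes the real symmetric positive definite $d\times d$ matrices, endowed with the Riemannian metric $g_X(\nu,\xi)=\mathrm{Tr}(X^{-1}\nu X^{-1}\xi)$; the geodesic between $X,Y\in\mathbb{S}^d_{++}$ is $X\#_tY:=X^{1/2}(X^{-1/2}YX^{-1/2})^tX^{1/2}$, $t\in[0,1]$. On a product of such spaces, geodesics are taken componentwise with a common parameter $t$. A positive function $h$ is jointly geodesically log-concave if $\log h$ is geodesically concave along all such (componentwise) geodesics. *)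

(* Defs.v *)
From HB Require Import structures.
From mathcomp Require Import all_boot all_order all_algebra.
From mathcomp Require Import all_classical all_reals all_analysis.

Set Implicit Arguments.
Unset Strict Implicit.
Unset Printing Implicit Defensive.

Import Order.TTheory GRing.Theory Num.Theory.
Import numFieldNormedType.Exports.

Local Open Scope classical_set_scope.
Local Open Scope ring_scope.

(* Lebesgue measure on R^n, realized on column vectors: the Caratheodory measure
   of the outer measure induced by coverings with countably many boxes. *)

Section lebesgue.
Variables (R : realType) (n : nat).
Implicit Types (ab : 'cV[R]_n * 'cV[R]_n) (X : set 'cV[R]_n).

Definition box ab : set 'cV[R]_n :=
  [set x | forall i, ab.1 i 0 <= x i 0 <= ab.2 i 0].

Definition box_volume ab : R :=
  \prod_(i < n) Num.max 0 (ab.2 i 0 - ab.1 i 0).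

Definition box_cover X : set (set ('cV[R]_n * 'cV[R]_n)) :=
  [set C | countable C /\ X `<=` \bigcup_(ab in C) box ab].

Definition lebesgue_outer X : \bar R :=
  ereal_inf [set (\esum_(ab in C) (box_volume ab)%:E)%E | C in box_cover X].

Local Open Scope ereal_scope.

Lemma box_volume_ge0 ab : 0 <= (box_volume ab)%:E.
Proof. by rewrite lee_fin prodr_ge0// => i _; rewrite le_max lexx. Qed.

Lemma lebesgue_outer_ge0 X : 0 <= lebesgue_outer X.
Proof.
apply: le_ereal_inf_tmp => _ [C _ <-].
by apply: esum_ge0 => ab _; exact: box_volume_ge0.
Qed.

Lemma lebesgue_outer0 : lebesgue_outer set0 = 0.
Proof.
apply/eqP; rewrite eq_le lebesgue_outer_ge0 andbT.
apply: ereal_inf_lbound; exists set0; last by rewrite esum_set0.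
by split.
Qed.

Lemma le_lebesgue_outer : {homo lebesgue_outer : X Y / X `<=` Y >-> X <= Y}.
Proof.
move=> X Y XY; apply/ereal_inf_le_tmp => _ [C [cC YC] <-].
by exists C => //; split => //; exact: subset_trans YC.
Qed.

Lemma lebesgue_outer_sigma_subadditive : sigma_subadditive lebesgue_outer.
Proof.
move=> F; have [[i Fioo]|] := pselect (exists i, lebesgue_outer (F i) = +oo).
  rewrite (eseries_pinfty _ _ Fioo) ?leey// => k _.
  by rewrite -ltNye (lt_le_trans _ (lebesgue_outer_ge0 _)).
rewrite -forallNE => Foo.
apply/lee_addgt0Pr => _/posnumP[e].
rewrite (le_trans _ (epsilon_trick _ _ _))//; last first.
  by move=> k; exact: lebesgue_outer_ge0.
pose P k C := box_cover (F k) C /\ \esum_(ab in C) (box_volume ab)%:E <=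
  lebesgue_outer (F k) + (e%:num / (2 ^ k.+1)%:R)%:E.
have [G PG] : {G & forall k, P k (G k)}.
  apply: (@choice _ _ P) => k.
  have en1 : (0 < e%:num / (2 ^ k.+1)%:R)%R by [].
  have Fk : lebesgue_outer (F k) \is a fin_num.
    by rewrite ge0_fin_numE ?lebesgue_outer_ge0// ltey; apply/eqP/Foo.
  have [_ [C CF <-] /ltW CFe] := lb_ereal_inf_adherent en1 Fk.
  by exists C.
apply: (@le_trans _ _ (\sum_(k <oo) \esum_(ab in G k) (box_volume ab)%:E));
    last first.
  apply: lee_nneseries => [k _ _|k _]; last exact: (PG k).2.
  by apply: esum_ge0 => ab _; exact: box_volume_ge0.
apply: (@le_trans _ _ (\esum_(ab in \bigcup_k G k) (box_volume ab)%:E)).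
  apply: ereal_inf_lbound; exists (\bigcup_k G k) => //; split.
    by apply: bigcup_countable => // k _; exact: (PG k).1.1.
  move=> x [k _ Fkx]; have [ab Gab xab] := (PG k).1.2 _ Fkx.
  by exists ab => //; exists k.
rewrite seqDU_bigcup_eq esum_bigcupT//=; last first.
  by move=> ab; exact: box_volume_ge0.
rewrite -nneseries_esumT; last first.
  by move=> k; apply: esum_ge0 => ab _; exact: box_volume_ge0.
apply: lee_nneseries => [k _ _|k _].
  by apply: esum_ge0 => ab _; exact: box_volume_ge0.
rewrite esum_mkcond [leRHS]esum_mkcond; apply: le_esum => ab _.
case: ifPn => [/set_mem Gab|_]; first by rewrite mem_set//; exact: subset_seqDU Gab.
by case: ifP => // _; exact: box_volume_ge0.
Qed.

HB.instance Definition _ := isOuterMeasure.Build R 'cV[R]_n lebesgue_outer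
  lebesgue_outer0 lebesgue_outer_ge0 le_lebesgue_outer
  lebesgue_outer_sigma_subadditive.

Definition euclidean := caratheodory_type lebesgue_outer.
HB.instance Definition _ := Measurable.on euclidean.

Definition lebesgue_vol (X : set euclidean) : \bar R := lebesgue_outer X.
HB.instance Definition _ := isMeasure.Build _ euclidean R lebesgue_vol
  (@caratheodory_measure0 _ _ lebesgue_outer)
  (@caratheodory_measure_ge0 _ _ lebesgue_outer)
  (@caratheodory_measure_sigma_additive _ _ lebesgue_outer).

End lebesgue.

Section brascamp_lieb.
Variables (R : realType) (n m : nat) (d : 'I_m -> nat).
Variables (B : forall j, 'M[R]_(d j, n)) (p : 'I_m -> R).

Record bl_datum : Prop := BLDatum {
  bl_dim_gt0 : (0 < n)%N ;
  bl_num_gt0 : (0 < m)%N ;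
  bl_dims_gt0 : forall j, (0 < d j)%N ;
  bl_surj : forall j (y : 'cV[R]_(d j)), exists x : 'cV[R]_n, B j *m x = y ;
  bl_exp_ge0 : forall j, 0 <= p j }.

(* The products on the right-hand side are taken in [\bar R], where
   0 * +oo = 0 and x `^ 0 = 1 even for x = +oo. *)
Definition bl_inequality (C : R) :=
  forall f : (forall j, euclidean R (d j) -> R),
    (forall j, measurable_fun setT (f j)) ->
    (forall j x, 0 <= f j x) ->
  (\int[@lebesgue_vol R n]_x (\prod_(j < m) (f j (B j *m x)) `^ p j)%:E <=
   C%:E * \prod_(j < m)
     (\int[@lebesgue_vol R (d j)]_x (f j x)%:E) `^ p j)%E.

Definition bl_constant : \bar R :=
  ereal_inf [set C%:E | C in [set C | bl_inequality C]].

Definition bl_feasible := bl_datum /\ (bl_constant < +oo)%E.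

Definition bl_gauss (A : forall j, 'M[R]_(d j)) : R :=
  Num.sqrt ((\prod_(j < m) (\det (A j)) `^ p j) /
            \det (\sum_(j < m) p j *: ((B j)^T *m A j *m B j))).

End brascamp_lieb.

Section spd.
Variables (R : realType) (k : nat).
Implicit Types (X Y : 'M[R]_k).

Definition spd X : Prop :=
  X^T = X /\ forall v : 'cV[R]_k, v != 0 -> 0 < (v^T *m X *m v) 0 0.

Definition spectral_dec X (Ud : 'M[R]_k * 'rV[R]_k) : Prop :=
  Ud.1 *m Ud.1^T = 1%:M /\ X = Ud.1^T *m diag_mx Ud.2 *m Ud.1.

(* The real power X^s is computed on a spectral decomposition X = U^T D U, which
   exists for symmetric X; the result does not depend on the choice of (U, D). *)
Definition mxpowR X (s : R) : 'M[R]_k :=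
  let Ud := xget (1%:M, 0) [set Ud | spectral_dec X Ud] in
  Ud.1^T *m diag_mx (map_mx (fun a => a `^ s) Ud.2) *m Ud.1.

Definition geodesic X Y (t : R) : 'M[R]_k :=
  mxpowR X 2^-1 *m mxpowR (mxpowR X (- 2^-1) *m Y *m mxpowR X (- 2^-1)) t
    *m mxpowR X 2^-1.

End spd.

Definition jointly_geodesically_log_concave (R : realType) (m : nat)
    (d : 'I_m -> nat) (h : (forall j, 'M[R]_(d j)) -> R) : Prop :=
  forall P Q : (forall j, 'M[R]_(d j)),
    (forall j, spd (P j)) -> (forall j, spd (Q j)) ->
  forall t : R, 0 <= t <= 1 ->
    (1 - t) * ln (h P) + t * ln (h Q) <=
    ln (h (fun j => geodesic (P j) (Q j) t)).

(* Main.v *)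
Require Import Defs.
From mathcomp Require Import all_boot all_order all_fingroup all_algebra.
From mathcomp Require Import all_classical all_reals all_analysis.
From mathcomp Require Import spectral complex unstable ring lra.

(* Diagonalizing P_j and Q_j simultaneously by congruence, P_j = S_j^T S_j and
   Q_j = S_j^T diag(l_j) S_j, turns the geodesic into S_j^T diag(l_j^t) S_j. Hence
   the numerator of BL(B,p;A)^2 is log-affine in t, while its denominator is the
   determinant of a sum of rank-one matrices p_j (l_jk)^t v_jk v_jk^T, which by
   Cauchy-Binet has the form sum_f a_f (L_f)^t with a_f >= 0 and L_f > 0 and is
   thus log-convex. If all a_f vanish, the denominator vanishes along the whole
   geodesic and, with x / 0 = 0 and ln 0 = 0, all three logarithms are 0. *)

Set Implicit Arguments.
Unset Strict Implicit.
Unset Printing Implicit Defensive.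

Import Order.TTheory GRing.Theory Num.Theory.
Local Open Scope classical_set_scope.
Local Open Scope ring_scope.

(** * Real eigenvectors, reflections and determinants of rank-one sums *)

(** An eigenvalue [c] exists over [R[i]]. The matrix is Hermitian there, so [v A v^*] equals its own
    conjugate; it is also [c] times the positive number [v v^*], hence [c] is real. A real root of
    the characteristic polynomial then has a real eigenvector. *)
Lemma symmetric_eigenvector (R : rcfType) n (A : 'M[R]_n.+1) :
  A^T = A -> exists (a : R) (v : 'rV_n.+1), v != 0 /\ v *m A = a *: v.
Proof.
move=> symA; pose toC := real_complex R.
have [c eigc] := eigenvalue_closed (map_mx toC A) (ltn0Sn n).
suff /complex_realP[a ca] : c \is Num.real.
  exists a; have : root (char_poly A) a.
    rewrite -(fmorph_root toC) map_char_poly -eigenvalue_root_char.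
    by rewrite ca in eigc.
  by rewrite -eigenvalue_root_char => /eigenvalueP[v vA v0]; exists v.
have /eigenvalueP[v vA v0] := eigc.
have AC : (map_mx toC A)^t*%sesqui = map_mx toC A.
  apply/matrixP => i j; rewrite -[in RHS]symA !mxE.
  by rewrite conj_Creal//; apply/complex_realP; exists (A j i).
have vv0 : 0 < (v *m v^t*%sesqui) 0 0 by rewrite -dotmxE dotmx_is_dotmx.
have vAv : v *m map_mx toC A *m v^t*%sesqui = c *: (v *m v^t*%sesqui).
  by rewrite vA -scalemxAl.
have : (v *m map_mx toC A *m v^t*%sesqui)^t*%sesqui
    = v *m map_mx toC A *m v^t*%sesqui.
  rewrite !trmx_mul !map_mxM /= AC mulmxA; congr (_ *m _ *m _).
  by apply/matrixP => i j; rewrite !mxE conjCK.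
rewrite vAv => /matrixP/(_ 0 0).
move: (v *m v^t*%sesqui) vv0 => w vv0; rewrite !mxE rmorphM /=.
rewrite (conj_Creal (gtr0_real vv0)).
by move/(mulIf (lt0r_neq0 vv0))/CrealP.
Qed.

Lemma mulmx_tr_eq0 (R : realDomainType) n (v : 'rV[R]_n) :
  v *m v^T = 0 -> v = 0.
Proof.
move=> /matrixP/(_ 0 0); rewrite !mxE => vv; apply/rowP => i.
have vv_ge0 j : true -> 0 <= v 0 j * v^T j 0 by rewrite mxE -expr2 sqr_ge0.
have /eqP : v 0 i * v^T i 0 = 0 := psumr_eq0P vv_ge0 vv isT.
by rewrite !mxE -expr2 sqrf_eq0 => /eqP.
Qed.

(* The Householder reflection exchanging the first basis vector and [v]. *)
Lemma orthogonal_first_row (R : realFieldType) n (v : 'rV[R]_n.+1) :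
  v *m v^T = 1%:M ->
  exists H : 'M[R]_n.+1, H^T = H /\ H *m H = 1%:M /\ delta_mx 0 0 *m H = v.
Proof.
move=> vv; pose e : 'rV[R]_n.+1 := delta_mx 0 0; pose u := e - v.
have ee : e *m e^T = 1%:M.
  by rewrite trmx_delta mul_delta_mx; apply/matrixP => i j; rewrite !ord1 !mxE.
(* For [u = 0] there is no hyperplane to reflect in, but then [v] is already the first basis
   vector. *)
have [u0|u_neq0] := eqVneq u 0.
  exists 1%:M; rewrite trmx1 !mulmx1; split => //; split => //.
  by rewrite -[RHS](addr0) -u0 addrC subrK.
pose c := (e *m v^T) 0 0.
have ev : e *m v^T = c%:M by rewrite [LHS]mx11_scalar.
have ve : v *m e^T = c%:M.
  by rewrite -[LHS]trmxK trmx_mul trmxK ev tr_scalar_mx.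
pose s := 1 - c.
have eu : e *m u^T = s%:M.
  by rewrite linearB /= mulmxBr ee ev -raddfB.
have uu : u *m u^T = (s *+ 2)%:M.
  rewrite {1}/u mulmxBl eu linearB /= mulmxBr ve vv -!raddfB.
  by congr _%:M; rewrite /s; ring.
have s_neq0 : s != 0.
  apply: contra u_neq0 => /eqP s0; apply/eqP/mulmx_tr_eq0.
  by rewrite uu s0 mul0rn raddf0.
have <- : e - u = v by rewrite /u opprB addrC subrK.
(* As [u u^T = 2s], this is the usual [1 - 2 u^T u / |u|^2]; [e u^T = s] makes it send [e] to
   [e - u = v]. *)
clearbody u; exists (1%:M - s^-1 *: (u^T *m u)); split; last split.
- by rewrite linearB /= trmx1 linearZ /= trmx_mul trmxK.
- rewrite mulmxBl mul1mx mulmxBr mulmx1 -scalemxAl -scalemxAr.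
  rewrite mulmxA -(mulmxA _ u) uu mul_mx_scalar -scalemxAl !scalerA.
  have -> : s^-1 * (s^-1 * (s *+ 2)) = s^-1 + s^-1 by field.
  by rewrite scalerDl opprB addrK subrK.
- rewrite mulmxBr mulmx1 -scalemxAr mulmxA eu mul_scalar_mx scalerA mulVf//.
  by rewrite scale1r.
Qed.

(* Cauchy-Binet, summed over all maps [f] instead of increasing ones so that each
   minor is counted [n`!] times. *)
Lemma det_sum_rank1 (R : comNzRingType) n (I : finType) (w : I -> R)
    (v : I -> 'I_n -> R) :
  n`!%:R * \det (\matrix_(a, b) \sum_i w i * (v i a * v i b)) =
  \sum_(f : {ffun 'I_n -> I})
     (\prod_a w (f a)) * (\det (\matrix_(a, b) v (f a) b)) ^+ 2.
Proof.
(* Distributing the product over rows chooses one index [f a] per row; the signed sum over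
   permutations then rebuilds one factor as a determinant. *)
have detE : \det (\matrix_(a, b) \sum_i w i * (v i a * v i b)) =
    \sum_(f : {ffun 'I_n -> I}) (\prod_a w (f a)) *
      ((\prod_a v (f a) a) * \det (\matrix_(a, b) v (f a) b)).
  rewrite /determinant.
  under eq_bigr => s _.
    under eq_bigr do rewrite mxE.
    rewrite bigA_distr_bigA /= big_distrr /=; over.
  rewrite exchange_big; apply: eq_bigr => f _ /=.
  rewrite !big_distrr /=; apply: eq_bigr => s _.
  rewrite !big_split /= !mulrA; congr (_ * _); last first.
    by apply: eq_bigr => a _; rewrite mxE.
  by rewrite -mulrA mulrC.
(* Replacing [f] by its composite with the inverse of [s] permutes the rows of the minor, which
   yields the sign of [s]. Summing over all [s] turns the remaining product into a second copy of
   the minor. *)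
have perm_invariant (s : 'S_n) :
    \det (\matrix_(a, b) \sum_i w i * (v i a * v i b)) =
    \sum_(f : {ffun 'I_n -> I}) (\prod_a w (f a)) *
      (((-1) ^+ s * \prod_a v (f a) (s a)) * \det (\matrix_(a, b) v (f a) b)).
  rewrite detE.
  pose h (f : {ffun 'I_n -> I}) := [ffun a => f (s a)].
  pose h' (f : {ffun 'I_n -> I}) := [ffun a => f (s^-1%g a)].
  rewrite (reindex h'); last first.
    exists h => f _; apply/ffunP => a; rewrite !ffunE.
      by rewrite permK.
    by rewrite permKV.
  apply: eq_bigr => f _; congr (_ * _).
    rewrite (reindex_inj (@perm_inj _ s)) /=.
    by apply: eq_bigr => a _; rewrite ffunE permK.
  rewrite (reindex_inj (@perm_inj _ s)) /=.
  under eq_bigr do rewrite ffunE permK.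
  have -> : \matrix_(a, b) v (h' f a) b = row_perm s^-1 (\matrix_(a, b) v (f a) b).
    by apply/matrixP => a b; rewrite !mxE ffunE.
  rewrite row_permE det_mulmx det_perm odd_permV.
  by rewrite mulrA [X in X * _]mulrC.
transitivity (\sum_(s : 'S_n) \det (\matrix_(a, b) \sum_i w i * (v i a * v i b))).
  rewrite sumr_const mulr_natl; congr (_ *+ _).
  by rewrite -card_Sn; apply: eq_card => s; rewrite !inE.
under eq_bigr => s _ do rewrite (perm_invariant s).
rewrite exchange_big; apply: eq_bigr => f _ /=.
rewrite -big_distrr -big_distrl /= expr2; congr (_ * (_ * _)).
by apply: eq_bigr => s _; congr (_ * _); apply: eq_bigr => a _; rewrite mxE.
Qed.

(** * Orthogonal diagonalization of symmetric matrices *)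

(** Induction on the size: a reflection [H] carries the first basis vector to a unit eigenvector, so
    the first row of [H A H] vanishes off the diagonal. By symmetry so does the first column, and
    the remaining block is symmetric. *)
Lemma symmetric_diagonalizable (R : rcfType) n (A : 'M[R]_n) : A^T = A ->
  exists (U : 'M[R]_n) (D : 'rV[R]_n),
    U *m U^T = 1%:M /\ A = U^T *m diag_mx D *m U.
Proof.
elim: n A => [|n IHn] A symA.
  by exists 1%:M, 0; split; apply/matrixP => -[].
have [a [v [v_neq0 vA]]] := symmetric_eigenvector symA.
pose c := (v *m v^T) 0 0.
have vv : v *m v^T = c%:M by rewrite [LHS]mx11_scalar.
have c_gt0 : 0 < c.
  rewrite lt_def; apply/andP; split.
    apply: contra v_neq0 => /eqP c0; apply/eqP/mulmx_tr_eq0.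
    by rewrite vv c0 raddf0.
  by rewrite /c mxE sumr_ge0// => i _; rewrite mxE -expr2 sqr_ge0.
pose r := (Num.sqrt c)^-1.
have ww : (r *: v) *m (r *: v)^T = 1%:M.
  rewrite linearZ -scalemxAl -scalemxAr scalerA vv -scalemx1 scalerA.
  by rewrite -invfM -expr2 sqr_sqrtr ?ltW// mulVf ?gt_eqF// scale1r.
have wA : (r *: v) *m A = a *: (r *: v).
  by rewrite -scalemxAl vA !scalerA mulrC.
have [H [HT [HH eH]]] := orthogonal_first_row ww.
have eHAH : delta_mx 0 0 *m (H *m A *m H) = a *: delta_mx 0 0 :> 'rV_n.+1.
  by rewrite !mulmxA eH wA -scalemxAl -eH -mulmxA HH mulmx1.
have symHAH : (H *m A *m H)^T = H *m A *m H.
  by rewrite !trmx_mul HT symA mulmxA.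
pose M : 'M[R]_(1 + n) := H *m A *m H.
have M0 j : M 0 j = a * (j == 0)%:R.
  have /rowP/(_ j) := eHAH; rewrite -rowE [LHS]mxE => ->.
  by rewrite !mxE eqxx.
have MT : M^T = M := symHAH.
have ulM : ulsubmx M = a%:M.
  apply/matrixP => i j; rewrite !ord1 [LHS]mxE mxE lshift0 M0.
  by rewrite mulr1 mxE.
have urM : ursubmx M = 0.
  apply/matrixP => i j; rewrite !ord1 [LHS]mxE mxE lshift0 M0.
  by rewrite [RHS]mxE mulr0.
have dlM : dlsubmx M = 0 by rewrite -MT -trmx_ursub urM trmx0.
have [U [D [UU drE]]] : exists (U : 'M[R]_n) (D : 'rV[R]_n),
    U *m U^T = 1%:M /\ drsubmx M = U^T *m diag_mx D *m U.
  by apply: IHn; rewrite trmx_drsub MT.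
pose V : 'M[R]_(1 + n) := block_mx 1%:M 0 0 U.
have VV : V *m V^T = 1%:M.
  rewrite /V tr_block_mx mulmx_block.
  rewrite !(trmx0, trmx1, mulmx0, mul0mx, mulmx1, addr0, add0r) UU.
  by rewrite -scalar_mx_block.
have VDV : V^T *m diag_mx (row_mx a%:M D) *m V = M.
  rewrite diag_mx_row /V tr_block_mx !mulmx_block -[RHS]submxK ulM urM dlM drE.
  rewrite !(trmx0, trmx1, mulmx0, mul0mx, mulmx1, mul1mx, addr0, add0r).
  by congr block_mx; apply/matrixP => i j; rewrite !ord1 !mxE.
exists ((V : 'M[R]_n.+1) *m H), (row_mx a%:M D).
rewrite trmx_mul HT; split.
  by rewrite mulmxA -(mulmxA _ H H) HH mulmx1.
rewrite -!mulmxA (mulmxA V^T) (mulmxA _ V) VDV -[LHS]mulmx1 -HH /M !mulmxA.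
by rewrite HH mul1mx.
Qed.

(** * Real powers and geodesics of positive definite matrices *)

Lemma spd_unitmx (R : realType) k (X : 'M[R]_k) : spd X -> X \in unitmx.
Proof.
move=> [_ posX]; rewrite -row_free_unit -kermx_eq0.
apply/rowV0P => v /sub_kermxP vX; apply/eqP/negPn/negP => v0.
have vT0 : v^T != 0 by rewrite trmx_eq0.
by have := posX _ vT0; rewrite trmxK vX mul0mx mxE ltxx.
Qed.

Lemma spd_congr (R : realType) k (X G : 'M[R]_k) :
  spd X -> G^T = G -> G \in unitmx -> spd (G *m X *m G).
Proof.
move=> [symX posX] symG unitG; split.
  by rewrite !trmx_mul symX symG mulmxA.
move=> v v0; have Gv0 : G *m v != 0.
  apply: contra v0 => /eqP Gv; apply/eqP.
  by rewrite -[v](mulKmx unitG) Gv mulmx0.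
by have := posX _ Gv0; rewrite trmx_mul symG !mulmxA.
Qed.

(** The decomposition picked by [xget] does not depend on the exponent, so a single pair [(U, D)]
    serves all powers of [X]. *)
Lemma mxpowR_spectral (R : realType) k (X : 'M[R]_k) : spd X ->
  exists (U : 'M[R]_k) (D : 'rV[R]_k),
    [/\ U *m U^T = 1%:M, X = U^T *m diag_mx D *m U, forall i, 0 < D 0 i &
      forall s, mxpowR X s = U^T *m diag_mx (map_mx (fun a => a `^ s) D) *m U].
Proof.
move=> [symX posX]; rewrite /mxpowR; case: xgetP; last first.
  have [U [D [UU XE]]] := symmetric_diagonalizable symX.
  by move=> /(_ (U, D)); case.
move=> [U D] _ [/= UU XE]; exists U, D; split=> // i.
(* The quadratic form of [X] at the [i]-th row of [U] equals [D 0 i], so positivity needs only that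
   this row be nonzero. *)
have u0 : (row i U)^T != 0.
  rewrite trmx_eq0; apply/eqP => Ui0.
  have : row i (U *m U^T) 0 i = 0 by rewrite row_mul Ui0 mul0mx mxE.
  by rewrite UU !mxE eqxx; apply/eqP; rewrite oner_eq0.
have := posX _ u0; rewrite trmxK XE.
rewrite rowE trmx_mul !mulmxA -[_ *m U *m U^T]mulmxA UU mulmx1.
rewrite -[_ *m U *m U^T]mulmxA UU mulmx1.
by rewrite -rowE trmx_delta -colE !mxE eqxx mulr1n.
Qed.

Lemma mxpowR_mul (R : realType) k (X : 'M[R]_k) (r s : R) : spd X ->
  mxpowR X r *m mxpowR X s = mxpowR X (r + s).
Proof.
move=> /mxpowR_spectral[U [D [UU _ D_gt0 powE]]]; rewrite !powE.
rewrite !mulmxA -[_ *m U *m U^T]mulmxA UU mulmx1 -[U^T *m _ *m _]mulmxA.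
rewrite mulmx_diag; congr (_ *m diag_mx _ *m _); apply/rowP => i; rewrite !mxE.
by rewrite powRD// (gt_eqF (D_gt0 i)) implybT.
Qed.

Lemma mxpowR0 (R : realType) k (X : 'M[R]_k) : spd X -> mxpowR X 0 = 1%:M.
Proof.
move=> /mxpowR_spectral[U [D [UU _ D_gt0 ->]]].
have -> : map_mx (fun a => a `^ 0) D = const_mx 1.
  by apply/rowP => i; rewrite !mxE powRr0.
by rewrite diag_const_mx mulmx1 (mulmx1C UU).
Qed.

Lemma mxpowR1 (R : realType) k (X : 'M[R]_k) : spd X -> mxpowR X 1 = X.
Proof.
move=> /mxpowR_spectral[U [D [UU XE D_gt0 ->]]]; rewrite [RHS]XE.
congr (_ *m diag_mx _ *m _); apply/rowP => i.
by rewrite mxE powRr1// ltW.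
Qed.

Lemma mxpowR_tr (R : realType) k (X : 'M[R]_k) (s : R) : spd X ->
  (mxpowR X s)^T = mxpowR X s.
Proof.
move=> /mxpowR_spectral[U [D [_ _ _ ->]]].
by rewrite !trmx_mul trmxK tr_diag_mx mulmxA.
Qed.

Definition congr_diag (R : realType) k (S : 'M[R]_k) (l : 'rV[R]_k) (t : R) :
    'M[R]_k :=
  S^T *m diag_mx (map_mx (fun a => a `^ t) l) *m S.

(** Diagonalize [X^(-1/2) Y X^(-1/2) = U^T diag(l) U] and take [S = U X^(1/2)]: powers of the middle
    matrix act on [l] alone, and the values at 0 and 1 are [X] and [Y]. *)
Lemma geodesic_congr_diag (R : realType) k (X Y : 'M[R]_k) : spd X -> spd Y ->
  exists (S : 'M[R]_k) (l : 'rV[R]_k),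
    [/\ S \in unitmx, forall i, 0 < l 0 i,
      X = congr_diag S l 0, Y = congr_diag S l 1 &
      forall t, geodesic X Y t = congr_diag S l t].
Proof.
move=> spdX spdY; pose H := mxpowR X 2^-1; pose G := mxpowR X (- 2^-1).
have HT : H^T = H := mxpowR_tr _ spdX.
have GH : G *m H = 1%:M by rewrite mxpowR_mul// addNr mxpowR0.
have HG : H *m G = 1%:M := mulmx1C GH.
have HH : H *m H = X.
  by rewrite mxpowR_mul// -[RHS]mxpowR1//; congr mxpowR; field.
have [_ unitG] := mulmx1_unit HG; have [_ unitH] := mulmx1_unit GH.
have GT : G^T = G := mxpowR_tr _ spdX.
have spdW : spd (G *m Y *m G) := spd_congr spdY GT unitG.
have [U [l [UU WE l_gt0 powE]]] := mxpowR_spectral spdW.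
have AE t : congr_diag (U *m H) l t = geodesic X Y t.
  by rewrite /geodesic /congr_diag powE trmx_mul HT !mulmxA.
exists (U *m H), l; split => //=.
- by rewrite unitmx_mul unitH andbT; case: (mulmx1_unit UU).
- by rewrite AE /geodesic mxpowR0// mulmx1 HH.
- rewrite AE /geodesic mxpowR1// -/H -/G; clearbody H G.
  rewrite !mulmxA HG mul1mx.
  by rewrite -mulmxA GH mulmx1.
Qed.

(** * Log-convexity of sums of exponentials *)

(** Weighted arithmetic-geometric mean inequality for [x] and 1, from the concavity of [ln]. *)
Lemma powR_le_chord (R : realType) (x t : R) : 0 < x -> 0 <= t <= 1 ->
  x `^ t <= (1 - t) + t * x.
Proof.
move=> x_gt0 /andP[t_ge0 t_le1].
have := @concave_ln _ (Itv01 t_ge0 t_le1) _ _ x_gt0 ltr01.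
rewrite !convRE/= /onem ln1 mulr0 addr0 mulr1 addrC => tln.
rewrite -ler_ln ?posrE ?powR_gt0 ?ln_powR//.
(* The right-hand side must be positive: [t * x] ensures this unless [t = 0], where it equals 1. *)
have [->|t_neq0] := eqVneq t 0; first by rewrite subr0 mul0r addr0.
by rewrite ltr_wpDl ?subr_ge0 ?mulr_gt0// lt_def t_neq0.
Qed.

Lemma sum_powR_gt0 (R : realType) (I : finType) (a L : I -> R) (t : R) :
  (forall i, 0 <= a i) -> (forall i, 0 < L i) -> 0 < \sum_i a i ->
  0 < \sum_i a i * L i `^ t.
Proof.
move=> a_ge0 L_gt0 sum_gt0.
have F_ge0 i : true -> 0 <= a i * L i `^ t by rewrite mulr_ge0 ?powR_ge0.
rewrite lt_def sumr_ge0// andbT; apply: contraTN sum_gt0 => /eqP/(psumr_eq0P F_ge0).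
move=> F0; rewrite big1 ?ltxx// => i _; have /eqP := F0 i isT.
by rewrite mulf_eq0 (gt_eqF (powR_gt0 _ (L_gt0 i))) orbF => /eqP.
Qed.

(** This is the logarithm of the Hölder bound [s0^(1-t) s1^t], where [s0] and [s1] are the sums at
    exponents 0 and 1. *)
Lemma ln_sum_powR_convex (R : realType) (I : finType) (a L : I -> R) (t : R) :
  (forall i, 0 <= a i) -> (forall i, 0 < L i) -> 0 < \sum_i a i -> 0 <= t <= 1 ->
  ln (\sum_i a i * L i `^ t) <=
    (1 - t) * ln (\sum_i a i * L i `^ 0) + t * ln (\sum_i a i * L i `^ 1).
Proof.
move=> a_ge0 L_gt0 sum_gt0 t01.
have s1_gt0 := sum_powR_gt0 1 a_ge0 L_gt0 sum_gt0.
have st_gt0 := sum_powR_gt0 t a_ge0 L_gt0 sum_gt0.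
have s0E : \sum_i a i * L i `^ 0 = \sum_i a i.
  by apply: eq_bigr => i _; rewrite powRr0 mulr1.
have s1E : \sum_i a i * L i `^ 1 = \sum_i a i * L i.
  by apply: eq_bigr => i _; rewrite powRr1// ltW.
rewrite s1E in s1_gt0; rewrite s0E s1E.
set s0 := \sum_i a i in sum_gt0 *; set s1 := \sum_i a i * L i in s1_gt0 *.
(* The ratio [s1 / s0] is the [a]-weighted mean of [L]. After division of each [L i] by it, the
   chord bounds sum to exactly [s0]. *)
have c_gt0 : 0 < s1 / s0 by rewrite divr_gt0.
have bound : \sum_i a i * L i `^ t <= (s1 / s0) `^ t * s0.
  have -> : (s1 / s0) `^ t * s0 =
      \sum_i (s1 / s0) `^ t * (a i * ((1 - t) + t * (L i / (s1 / s0)))).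
    rewrite -big_distrr /=; congr (_ * _).
    transitivity (\sum_i ((1 - t) * a i + t / (s1 / s0) * (a i * L i))).
      rewrite big_split /= -!big_distrr /= -/s0 -/s1.
      by field; rewrite !lt0r_neq0.
    by apply: eq_bigr => i _; rewrite mulrDr; congr (_ + _);
      [ring|field; rewrite !lt0r_neq0].
  apply: ler_sum => i _; rewrite mulrCA ler_wpM2l//.
  have {1}-> : L i = (s1 / s0) * (L i / (s1 / s0)).
    by rewrite mulrC divfK ?lt0r_neq0.
  have Lc_gt0 : 0 < L i / (s1 / s0) by rewrite divr_gt0.
  rewrite (powRM _ (ltW c_gt0) (ltW Lc_gt0)).
  by rewrite ler_wpM2l ?powR_ge0// powR_le_chord.
have /le_trans : ln (\sum_i a i * L i `^ t) <= ln ((s1 / s0) `^ t * s0).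
  by rewrite ler_ln ?posrE// mulr_gt0// powR_gt0.
apply.
rewrite lnM ?posrE ?powR_gt0// ln_powR ln_div ?posrE//.
by rewrite le_eqVlt; apply/orP; left; apply/eqP; ring.
Qed.

(** * Numerator and denominator along the geodesic *)

Lemma powR_prod (R : realType) (I : finType) (F : I -> R) (t : R) :
  (forall i, 0 <= F i) -> \prod_i (F i `^ t) = (\prod_i F i) `^ t.
Proof.
move=> F_ge0.
suff [] : 0 <= \prod_i F i /\ \prod_i (F i `^ t) = (\prod_i F i) `^ t by [].
apply: (big_ind2 (fun x y => 0 <= y /\ x = y `^ t)) => [|x1 x2 y1 y2|i _].
- by rewrite powR1.
- by move=> [x2_ge0 ->] [y2_ge0 ->]; rewrite powRM// mulr_ge0.
- by [].
Qed.

(** Each determinant is [(\det S_j)^2] times the [t]-th power of the product of the entries of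
    [l_j]; [C] collects the former factors and [q] the bases of the latter. *)
Lemma prod_det_congr_diag (R : realType) (m : nat) (d : 'I_m -> nat)
    (S : forall j, 'M[R]_(d j)) (l : forall j, 'rV[R]_(d j)) (p : 'I_m -> R) :
  (forall j, S j \in unitmx) -> (forall j i, 0 < l j 0 i) ->
  exists C q : R, [/\ 0 < C, 0 < q &
    forall t, \prod_j (\det (congr_diag (S j) (l j) t)) `^ p j = C * q `^ t].
Proof.
move=> S_unit l_gt0; have prod_gt0 j : 0 < \prod_i l j 0 i by rewrite prodr_gt0.
have det_gt0 j : 0 < \det (S j) ^+ 2.
  by rewrite exprn_even_gt0//= -unitfE -unitmxE.
exists (\prod_j (\det (S j) ^+ 2) `^ p j), (\prod_j (\prod_i l j 0 i) `^ p j).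
split=> [||t]; try by rewrite prodr_gt0// => j _; rewrite powR_gt0.
rewrite -powR_prod => [|j]; last exact: powR_ge0.
rewrite -big_split; apply: eq_bigr => j _ /=.
rewrite powRAC -powRM ?powR_ge0 ?(ltW (det_gt0 j))//; congr (_ `^ _).
rewrite !det_mulmx det_tr det_diag mulrAC -expr2; congr (_ * _).
rewrite -powR_prod => [|i]; last exact: ltW.
by apply: eq_bigr => i _; rewrite mxE.
Qed.

(** The rank-one terms are indexed by pairs [(j, k)], with vector the [k]-th row of [S_j B_j] and
    weight [p_j (l_jk)^t]. The factor [n!] comes from [det_sum_rank1]. *)
Lemma det_sum_congr_diag (R : realType) (n m : nat) (d : 'I_m -> nat)
    (S : forall j, 'M[R]_(d j)) (l : forall j, 'rV[R]_(d j))
    (B : forall j, 'M[R]_(d j, n)) (p : 'I_m -> R) :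
  (forall j i, 0 < l j 0 i) -> (forall j, 0 <= p j) ->
  exists a L : {ffun 'I_n -> {j : 'I_m & 'I_(d j)}} -> R,
    [/\ forall f, 0 <= a f, forall f, 0 < L f &
      forall t,
        n`!%:R * \det (\sum_j p j *: ((B j)^T *m congr_diag (S j) (l j) t *m B j)) =
        \sum_f a f * L f `^ t].
Proof.
move=> l_gt0 p_ge0.
pose v (i : {j : 'I_m & 'I_(d j)}) c :=
  (S (tag i) *m B (tag i)) (tagged i) c.
(* The exponents [p] may vanish, so they go into [a] with the squared minor; [L] keeps only the
   positive entries of [l]. *)
exists (fun f => (\prod_c p (tag (f c))) *
  \det (\matrix_(c, e) v (f c) e) ^+ 2).
exists (fun f => \prod_c l (tag (f c)) 0 (tagged (f c))).
split=> [f|f|t].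
- by rewrite mulr_ge0 ?sqr_ge0// prodr_ge0.
- by rewrite prodr_gt0.
pose w (i : {j : 'I_m & 'I_(d j)}) := p (tag i) * l (tag i) 0 (tagged i) `^ t.
transitivity (n`!%:R * \det (\matrix_(c, e) \sum_i w i * (v i c * v i e))).
  congr (_ * \det _); apply/matrixP => c e; rewrite summxE mxE.
  rewrite -(@sig_big_dep _ _ _ _ (fun j : 'I_m => 'I_(d j)) xpredT
    (fun _ _ => true) (fun j k => p j * l j 0 k `^ t *
      ((S j *m B j) k c * (S j *m B j) k e))) /=.
  apply: eq_bigr => j _; rewrite /congr_diag !mulmxA -trmx_mul -!mulmxA mulmxA.
  rewrite mxE mul_mx_diag mxE big_distrr; apply: eq_bigr => k _ /=.
  rewrite [_ c k]mxE [_^T _ _]mxE [map_mx _ _ _ _]mxE.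
  by rewrite [(_ *m _) k c * _]mulrC !mulrA.
rewrite det_sum_rank1; apply: eq_bigr => f _.
rewrite -powR_prod => [|c]; last exact: ltW.
by rewrite mulrAC -big_split.
Qed.

(** * Families of geodesics and the final concavity argument *)

(** The choice of [S] and [l] is made for all [j] at once, and the equations are between whole
    families so that they can be rewritten inside [bl_gauss]. *)
Lemma geodesic_family_congr_diag (R : realType) (m : nat) (d : 'I_m -> nat)
    (P Q : forall j, 'M[R]_(d j)) :
  (forall j, spd (P j)) -> (forall j, spd (Q j)) ->
  exists (S : forall j, 'M[R]_(d j)) (l : forall j, 'rV[R]_(d j)),
    [/\ forall j, S j \in unitmx, forall j i, 0 < l j 0 i,
      P = (fun j => congr_diag (S j) (l j) 0),
      Q = (fun j => congr_diag (S j) (l j) 1) &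
      forall t, (fun j => geodesic (P j) (Q j) t) =
        (fun j => congr_diag (S j) (l j) t)].
Proof.
move=> spdP spdQ.
have spec j : {Sl : 'M[R]_(d j) * 'rV[R]_(d j) |
    [/\ Sl.1 \in unitmx, forall i, 0 < Sl.2 0 i,
      P j = congr_diag Sl.1 Sl.2 0, Q j = congr_diag Sl.1 Sl.2 1 &
      forall t, geodesic (P j) (Q j) t = congr_diag Sl.1 Sl.2 t]}.
  by apply: cid; have [S [l H]] := geodesic_congr_diag (spdP j) (spdQ j); exists (S, l).
exists (fun j => (sval (spec j)).1), (fun j => (sval (spec j)).2).
by split=> [j|j||| t]; try apply: functional_extensionality_dep => j;
  case: (svalP (spec j)).
Qed.

Lemma ln_sqrt_powR_ratio_concave (R : realType) (I : finType) (a L : I -> R)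
    (C q N t : R) (g : R -> R) :
  0 < C -> 0 < q -> 0 < N -> (forall i, 0 <= a i) -> (forall i, 0 < L i) ->
  0 <= t <= 1 ->
  (forall s, g s = Num.sqrt (C * q `^ s / ((\sum_i a i * L i `^ s) / N))) ->
  (1 - t) * ln (g 0) + t * ln (g 1) <= ln (g t).
Proof.
move=> C_gt0 q_gt0 N_gt0 a_ge0 L_gt0 t01 gE.
have [a_eq0|sum_neq0] := eqVneq (\sum_i a i) 0.
  have g0 s : ln (g s) = 0.
    rewrite gE big1 ?mul0r ?invr0 ?mulr0 ?sqrtr0 ?ln0// => i _.
    by rewrite (psumr_eq0P (fun i _ => a_ge0 i) a_eq0) ?mul0r.
  by rewrite (g0 0) (g0 1) (g0 t) !mulr0 addr0.
have sum_gt0 : 0 < \sum_i a i by rewrite lt_def sum_neq0 sumr_ge0.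
have ln_gE s : ln (g s) =
    2^-1 * (ln C + s * ln q - (ln (\sum_i a i * L i `^ s) - ln N)).
  have G_gt0 := sum_powR_gt0 s a_ge0 L_gt0 sum_gt0.
  have qs_gt0 : 0 < q `^ s by rewrite powR_gt0.
  rewrite gE; move: (\sum_i _) G_gt0 => G G_gt0.
  have num_gt0 : 0 < C * q `^ s by rewrite mulr_gt0.
  have den_gt0 : 0 < G / N by rewrite divr_gt0.
  rewrite -powR12_sqrt; last exact/ltW/divr_gt0.
  by rewrite ln_powR ln_div ?posrE// lnM ?posrE// ln_powR ln_div ?posrE.
have := ln_sum_powR_convex a_ge0 L_gt0 sum_gt0 t01.
rewrite (ln_gE 0) (ln_gE 1) (ln_gE t).
move: (ln (\sum_i a i * L i `^ 0)) (ln (\sum_i a i * L i `^ 1)).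
move: (ln (\sum_i a i * L i `^ t)) (ln C) (ln q) (ln N) => gt c x n g0 g1.
(* The terms in [c], [x] and [n] are affine in the parameter and cancel; half of the convexity
   inequality remains. *)
lra.
Qed.

Theorem theorem1p6 (R : realType) (n m : nat) (d : 'I_m -> nat)
    (B : forall j, 'M[R]_(d j, n)) (p : 'I_m -> R)
    (feas : bl_feasible B p) :
  jointly_geodesically_log_concave (bl_gauss B p).
Proof.
move=> P Q spdP spdQ t t01.
have [S [l [S_unit l_gt0 -> -> geodE]]] := geodesic_family_congr_diag spdP spdQ.
rewrite geodE.
have [C [q [C_gt0 q_gt0 numE]]] := prod_det_congr_diag p S_unit l_gt0.
have [a [L [a_ge0 L_gt0 denE]]] := det_sum_congr_diag S B l_gt0 (bl_exp_ge0 feas.1).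
have N_gt0 : 0 < n`!%:R :> R by rewrite ltr0n fact_gt0.
(* One formula covers both endpoints, [s = 0] and [s = 1], and the intermediate point [s = t]. *)
have gaussE s : bl_gauss B p (fun j => congr_diag (S j) (l j) s) =
    Num.sqrt (C * q `^ s / ((\sum_f a f * L f `^ s) / n`!%:R)).
  rewrite /bl_gauss numE -denE; congr (Num.sqrt (_ / _)).
  by rewrite mulrC mulKf ?lt0r_neq0.
exact: (ln_sqrt_powR_ratio_concave C_gt0 q_gt0 N_gt0 a_ge0 L_gt0 t01 gaussE).
Qed.
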